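(* Let $n,l\in\mathbb{N}$ (positive integers), let $\Omega\subset\mathbb{R}^n$ be open, and let $0<\alpha<1$. Then $$\alpha\text{-}AC^{(n)}(\Omega,\mathbb{R}^l)=1\text{-}AC^{(n)}(\Omega,\mathbb{R}^l)\cap AC_H^{(n)}(\Omega,\mathbb{R}^l),$$ that is, a function $f:\Omega\to\mathbb{R}^l$ is $\alpha$-absolutely continuous if and only if it is both $1$-absolutely continuous and in Hencl's class $AC_H^{(n)}(\Omega,\mathbb{R}^l)$.
   Context: $\mathcal{L}^n$ denotes Lebesgue measure on $\mathbb{R}^n$ and $|\cdot|$ the Euclidean norm. For $\mathbf{a},\mathbf{b}\in\mathbb{R}^n$ with $a_\nu<b_\nu$ for all $\nu$, the interval is $[\mathbf{a},\mathbf{b}]=\{\mathbf{x}\in\mathbb{R}^n: a_\nu\le x_\nu\le b_\nu,\ \nu=1,\dots,n\}$. For $0<\alpha\le 1$, $[\mathbf{a},\mathbf{b}]$ is called $\alpha$-regular if $$\frac{\mathcal{L}^n([\mathbf{a},\mathbf{b}])}{(\max_\nu|a_\nu-b_\nu|)^n}\ge\alpha$$ (so $1$-regular intervals are exactly the axis-parallel cubes). For $0<\alpha\le 1$, the class $\alpha\text{-}AC^{(n)}(\Omega,\mathbb{R}^l)$ of $\alpha$-absolutely continuous functions consists of all $f:\Omega\to\mathbb{R}^l$ such that for every $\varepsilon>0$ there is $\delta>0$ such that for every finite collection of pairwise disjoint $\alpha$-regular intervals $[\mathbf{a}_i,\mathbf{b}_i]\subset\Omega$, $i=1,\dots,k$,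 $$\sum_{i=1}^k\mathcal{L}^n([\mathbf{a}_i,\mathbf{b}_i])<\delta\ \Rightarrow\ \sum_{i=1}^k|f(\mathbf{a}_i)-f(\mathbf{b}_i)|^n<\varepsilon.$$ The class $1\text{-}AC^{(n)}(\Omega,\mathbb{R}^l)$ is the case $\alpha=1$ of this definition. The class $AC_H^{(n)}(\Omega,\mathbb{R}^l)$ (Hencl) consists of all $f:\Omega\to\mathbb{R}^l$ for which there exists $\lambda\in(0,1)$ (equivalently, by a known result of Hencl, for all $\lambda\in(0,1)$) such that for every $\varepsilon>0$ there is $\delta>0$ such that for every finite collection of pairwise disjoint closed Euclidean balls $B(\mathbf{x}_i,r_i)\subset\Omega$, $i=1,\dots,k$, $$\sum_{i=1}^k\mathcal{L}^n(B(\mathbf{x}_i,r_i))<\delta\ \Rightarrow\ \sum_{i=1}^k\big(\operatorname{osc}(f,B(\mathbf{x}_i,\lambda r_i))\big)^n<\varepsilon,$$ where $\operatorname{osc}(f,E)=\sup_{\mathbf{x},\mathbf{y}\in E}|f(\mathbf{x})-f(\mathbf{y})|$ is the oscillation of $f$ on $E$. *)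

(* Defs.v *)
From mathcomp Require Import all_boot all_order all_algebra.
From mathcomp Require Import all_classical all_reals all_analysis.

Set Implicit Arguments.
Unset Strict Implicit.
Unset Printing Implicit Defensive.

Import Order.TTheory GRing.Theory Num.Theory.
Local Open Scope classical_set_scope.
Local Open Scope ring_scope.

Section Defs.
Context {R : realType}.

(* The library norm on row vectors is the sup norm; it induces the same open
   sets as the Euclidean norm below. *)
Definition enorm n (x : 'rV[R]_n) : R :=
  Num.sqrt (\sum_(i < n) x ord0 i ^+ 2).

Definition cball n (x : 'rV[R]_n) (r : R) : set 'rV[R]_n :=
  [set y | enorm (y - x) <= r].

Definition closed_interval n (a b : 'rV[R]_n) : set 'rV[R]_n :=
  [set x | forall i, a ord0 i <= x ord0 i <= b ord0 i].

(* n-dimensional Lebesgue (outer) measure: the infimum of the total volumes of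
   countable covers by closed, possibly degenerate, intervals. It is applied
   only to closed intervals and balls, which are measurable. *)
Definition lebesgue n (A : set 'rV[R]_n) : \bar R :=
  ereal_inf [set s | exists c d : nat -> 'rV[R]_n,
    [/\ forall k i, c k ord0 i <= d k ord0 i,
        A `<=` \bigcup_k closed_interval (c k) (d k) &
        s = (\sum_(0 <= k <oo)
               (\prod_(i < n) (d k ord0 i - c k ord0 i))%:E)%E]].

Definition max_side n (a b : 'rV[R]_n) : R :=
  \big[Num.max/0]_(i < n) `|a ord0 i - b ord0 i|.

Definition alpha_regular n (alpha : R) (a b : 'rV[R]_n) : Prop :=
  (forall i, a ord0 i < b ord0 i) /\
  (alpha%:E <= lebesgue (closed_interval a b) / (max_side a b ^+ n)%:E)%E.

(* A function Omega -> R^l is represented by a total function; alpha_AC and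
   Hencl_AC depend only on its values on Omega. *)
Definition alpha_AC n l (alpha : R) (Omega : set 'rV[R]_n) :
    set ('rV[R]_n -> 'rV[R]_l) :=
  [set f | forall eps : R, 0 < eps -> exists2 delta : R, 0 < delta &
    forall (k : nat) (a b : 'I_k -> 'rV[R]_n),
      (forall i, alpha_regular alpha (a i) (b i)) ->
      (forall i, closed_interval (a i) (b i) `<=` Omega) ->
      trivIset setT (fun i => closed_interval (a i) (b i)) ->
      (\sum_(i < k) lebesgue (closed_interval (a i) (b i)) < delta%:E)%E ->
      \sum_(i < k) enorm (f (a i) - f (b i)) ^+ n < eps].

(* Extended-real valued, so that the oscillation of an unbounded function is
   +oo. *)
Definition osc n l (f : 'rV[R]_n -> 'rV[R]_l) (E : set 'rV[R]_n) : \bar R :=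
  ereal_sup [set (enorm (f x - f y))%:E | x in E & y in E].

Definition Hencl_AC n l (Omega : set 'rV[R]_n) : set ('rV[R]_n -> 'rV[R]_l) :=
  [set f | exists2 lambda : R, 0 < lambda < 1 &
    forall eps : R, 0 < eps -> exists2 delta : R, 0 < delta &
    forall (k : nat) (x : 'I_k -> 'rV[R]_n) (r : 'I_k -> R),
      (forall i, 0 < r i) ->
      (forall i, cball (x i) (r i) `<=` Omega) ->
      trivIset setT (fun i => cball (x i) (r i)) ->
      (\sum_(i < k) lebesgue (cball (x i) (r i)) < delta%:E)%E ->
      (\sum_(i < k) osc f (cball (x i) (lambda * r i)) ^+ n < eps%:E)%E].

End Defs.

Arguments alpha_AC {R n} l alpha Omega.
Arguments Hencl_AC {R n} l Omega.

(* Main.v *)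
Require Import Defs.
From mathcomp Require Import all_boot all_order all_algebra ring lra.
From mathcomp Require Import all_classical all_reals all_analysis.
From mathcomp Require Import measurable_realfun.

Set Implicit Arguments.
Unset Strict Implicit.
Unset Printing Implicit Defensive.

Import Order.TTheory GRing.Theory Num.Theory.
Import numFieldNormedType.Exports.
Local Open Scope classical_set_scope.
Local Open Scope ring_scope.

(** A cube is an [alpha]-regular interval. To control the oscillation of [f] on
    a small ball concentric with a ball [B] in [Omega], join two points [x], [y]
    of the small ball through a common lower corner [z] of the intervals [[z, x]]
    and [[z, y]]: if [z] lies far enough from the small ball, still inside [B],
    these are almost cubes, hence [alpha]-regular.

    Conversely, the sides of an [alpha]-regular interval [[a, b]] lie between
    [m] and [m / alpha], where [m] is [alpha] times the longest side. Go from [a]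
    to [b] along the diagonal of the cube [[a, a + (m/2) 1]], then along the
    segment from [a + (m/2) 1] to [b - (m/2) 1], which is covered by a bounded
    number of balls [lambda B] with [B] of radius [m/2] inside [[a, b]], then
    along the diagonal of the cube [[b - (m/2) 1, b]].

    All the auxiliary intervals and balls lie inside the given disjoint sets, so
    monotonicity of the measure suffices, together with the value of the measure
    on intervals. *)

(** * Volume of boxes under the covering definition of the measure *)

Section Volume.
Context {R : realType}.

(* Induction on the dimension by slicing along the last coordinate: the weights
   absorb the indicator functions of the last sides of the covering intervals,
   and the slice estimates are integrated over [`[a n, b n]]. *)
Lemma volume_le_weighted_cover (n : nat) (a b : nat -> R)
    (c d : nat -> nat -> R) (w : nat -> R) :
  (forall i, (i < n)%N -> a i <= b i) ->
  (forall k i, (i < n)%N -> c k i <= d k i) ->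
  (forall k, 0 <= w k) ->
  (forall x : nat -> R, (forall i, (i < n)%N -> a i <= x i <= b i) ->
    exists2 k, w k = 1 & forall i, (i < n)%N -> c k i <= x i <= d k i) ->
  ((\prod_(i < n) (b i - a i))%:E <=
   \sum_(0 <= k <oo) (w k * \prod_(i < n) (d k i - c k i))%:E)%E.
Proof.
elim: n w => [|n IHn] w leab lecd w_ge0 cover.
  (* In dimension 0 all products are 1, and the cover supplies an index of weight 1 whose single
     term already gives the bound. *)
  have [k wk _] := cover a ltac:(by []).
  have term_ge0 j : (0 <= (w j * \prod_(i < 0) (d j i - c j i))%:E)%E.
    by rewrite lee_fin big_ord0 mulr1.
  rewrite (nneseriesD1 (n := k)) //= !big_ord0 wk mulr1.
  by rewrite leeDl// nneseries_ge0.
pose P k := \prod_(i < n) (d k i - c k i).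
have P_ge0 k : 0 <= P k.
  by apply: prodr_ge0 => i _; rewrite subr_ge0 lecd// ltnW// ltnS.
pose I k := `[c k n, d k n]%classic.
pose D := `[a n, b n]%classic.
have mD : measurable D by exact: measurable_itv.
have mI k : measurable (I k) by exact: measurable_itv.
have slice x : D x ->
    ((\prod_(i < n) (b i - a i))%:E <=
     \sum_(0 <= k <oo) ((w k * P k)%:E * (\1_(I k) x)%:E))%E.
  rewrite /D/= in_itv/= => Dx.
  have := IHn (fun k => w k * \1_(I k) x).
  under eq_eseriesr do rewrite mulrAC EFinM.
  apply=> [i ltin|k i ltin|k|y ybox].
  - by rewrite leab// ltnW.
  - by rewrite lecd// ltnW.
  - by rewrite mulr_ge0.
  have [|k wk xk] := cover (fun i => if (i < n)%N then y i else x).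
    move=> i; rewrite ltnS leq_eqVlt => /predU1P[->|ltin].
      by rewrite ltnn.
    by rewrite ltin; exact: ybox.
  exists k => [|i ltin]; last by have := xk i (ltnW ltin); rewrite ltin.
  rewrite wk mul1r indicE mem_set// /I/= in_itv/=.
  by have := xk n (ltnSn n); rewrite ltnn.
have mes_itv (u v : R) : u <= v ->
    lebesgue_measure `[u, v]%classic = (v - u)%:E.
  move=> leuv; rewrite lebesgue_measure_itv/= lte_fin.
  by case: ltgtP leuv => // -> _; rewrite subrr.
have m1 k : measurable_fun D (fun x : R => (\1_(I k) x)%:E : \bar R).
  by apply/measurable_EFinP; apply: measurable_indic.
pose g k (x : R) : \bar R := ((w k * P k)%:E * (\1_(I k) x)%:E)%E.
have mg k : measurable_fun D (g k).
  by apply/measurable_EFinP; apply: measurable_funM => //; apply: measurable_indic.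
have g_ge0 k x : (0 <= g k x)%E.
  by rewrite mule_ge0// lee_fin// mulr_ge0.
rewrite big_ord_recr/=.
have -> : ((\prod_(i < n) (b i - a i) * (b n - a n))%:E =
    \int[lebesgue_measure]_(x in D) (\prod_(i < n) (b i - a i))%:E)%E.
  by rewrite integral_cst// [X in (_ * X)%E]mes_itv ?leab//.
apply: (@le_trans _ _ (\int[lebesgue_measure]_(x in D)
    (\sum_(0 <= k <oo) g k x))%E).
  apply: ge0_le_integral => //.
  - by move=> x _; rewrite lee_fin; apply: prodr_ge0 => i _;
      rewrite subr_ge0 leab// ltnW// ltnS.
  - by apply: (ge0_emeasurable_sum (P := xpredT)) => k *;
      [exact: g_ge0|exact: mg].
rewrite integral_nneseries//.
apply: lee_nneseries => k _; first by move=> _; apply: integral_ge0.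
rewrite ge0_integralZl_EFin// ?mulr_ge0//; last exact: m1.
rewrite integral_indic; [|exact: mD|exact: mI].
rewrite big_ord_recr/= mulrA [leRHS]EFinM.
apply: lee_wpmul2l; first by rewrite lee_fin mulr_ge0.
(* The integral of the indicator over [D] is the measure of the part of [I k] in [D], at most the
   last side of the [k]-th interval. *)
rewrite -mes_itv ?lecd//.
by apply: le_measure; rewrite ?inE//; apply: measurableI; [exact: mI|exact: mD].
Qed.

Lemma lebesgueS n (A B : set 'rV[R]_n) :
  A `<=` B -> (lebesgue A <= lebesgue B)%E.
Proof.
move=> subAB; apply: ereal_inf_le_tmp => _ [c [d [lecd coverB ->]]].
by exists c, d; split=> //; exact: subset_trans coverB.
Qed.

(** The interval covers itself, which bounds its measure from above; the bound from below is the
    weighted covering estimate with all weights 1. *)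
Lemma lebesgue_closed_interval n (a b : 'rV[R]_n.+1) :
  (forall i, a ord0 i <= b ord0 i) ->
  lebesgue (closed_interval a b) =
  (\prod_(i < n.+1) (b ord0 i - a ord0 i))%:E.
Proof.
move=> leab; apply/eqP; rewrite eq_le; apply/andP; split.
  apply: ereal_inf_lbound.
  (* All later intervals degenerate to the point [a]; their volume vanishes because the dimension is
     positive. *)
  exists (fun k => a), (fun k => if k == 0%N then b else a).
  split=> [k i|x abx|]; first by case: eqP.
    by exists 0%N.
  set p := (X in X%:E = _).
  rewrite (nneseriesD1 (n := 0%N))//=; last first.
    move=> k _; rewrite lee_fin; apply: prodr_ge0 => i _.
    by case: eqP; rewrite subr_ge0.
  rewrite eseries0 ?adde0// => k _ /= /negbTE ->.
  by rewrite (bigD1 ord0)//= subrr mul0r.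
apply/ereal_infP => _ [c [d [lecd cover ->]]].
pose nth (v : 'rV[R]_n.+1) i := v ord0 (inord i).
have := @volume_le_weighted_cover n.+1 (nth a) (nth b)
  (fun k => nth (c k)) (fun k => nth (d k)) (fun=> 1).
under eq_bigr do rewrite /nth inord_val.
under eq_eseriesr => k _.
  rewrite mul1r; under eq_bigr do rewrite /nth inord_val.
  over.
apply=> [i _|k i _|//|x xab]; [exact: leab|exact: lecd|].
have [|k _ kx] := cover (\row_i x i).
  by move=> i; rewrite mxE; have := xab _ (ltn_ord i); rewrite /nth inord_val.
exists k => // i ltin; have := kx (inord i).
by rewrite mxE inordK.
Qed.

End Volume.

(** * The Euclidean norm and chains of points *)

Section EuclideanNorm.
Context {R : realType}.

Lemma enorm_ge0 n (x : 'rV[R]_n) : 0 <= enorm x.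
Proof. exact: sqrtr_ge0. Qed.

Lemma enorm0 n : enorm (0 : 'rV[R]_n) = 0.
Proof. by rewrite /enorm big1 ?sqrtr0// => j _; rewrite mxE expr0n. Qed.

Lemma enormB n (x y : 'rV[R]_n) : enorm (x - y) = enorm (y - x).
Proof.
by congr Num.sqrt; apply: eq_bigr => i _; rewrite !mxE -sqrrN opprB.
Qed.

Lemma normr_coord_le_enorm n (x : 'rV[R]_n) i : `|x ord0 i| <= enorm x.
Proof.
rewrite -sqrtr_sqr ler_sqrt; last by apply: sumr_ge0 => j _; exact: sqr_ge0.
by rewrite (bigD1 i)//= lerDl; apply: sumr_ge0 => j _; exact: sqr_ge0.
Qed.

Lemma enorm_le_sum n (x : 'rV[R]_n) : enorm x <= \sum_(i < n) `|x ord0 i|.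
Proof.
have S_ge0 : 0 <= \sum_(i < n) `|x ord0 i| by exact: sumr_ge0.
rewrite -[leRHS]ger0_norm// -sqrtr_sqr ler_sqrt ?sqr_ge0//.
rewrite [leRHS]expr2 mulr_suml; apply: ler_sum => i _.
rewrite -real_normK ?num_real// expr2 ler_wpM2l//.
by rewrite (bigD1 i)//= lerDl sumr_ge0.
Qed.

Lemma enorm_le_coord n (x : 'rV[R]_n) t :
  (forall i, `|x ord0 i| <= t) -> enorm x <= n%:R * t.
Proof.
move=> xt; apply: (le_trans (enorm_le_sum x)).
apply: (@le_trans _ _ (\sum_(i < n) t)); first exact: ler_sum.
by rewrite sumr_const card_ord mulr_natl.
Qed.

(* The factor [l] comes from estimating each coordinate separately. *)
Lemma enorm_path l (g : nat -> 'rV[R]_l) m :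
  enorm (g 0%N - g m) <= l%:R * \sum_(j < m) enorm (g j - g j.+1).
Proof.
apply: enorm_le_coord => i.
have -> : g 0%N - g m = \sum_(j < m) (g j - g j.+1).
  rewrite -(big_mkord xpredT (fun j => g j - g j.+1)).
  by rewrite (@telescope_sumr_eq _ _ _ (fun j => - g j)) => [|//|j _];
    rewrite opprK addrC.
rewrite summxE; apply: (le_trans (ler_norm_sum _ _ _)).
by apply: ler_sum => j _; exact: normr_coord_le_enorm.
Qed.

(** Every term is at most the maximum [M], and [M ^+ n] is at most the sum of the [n]-th powers. *)
Lemma expr_sum_le n m (u : 'I_m -> R) : (0 < n)%N -> (forall j, 0 <= u j) ->
  (\sum_(j < m) u j) ^+ n <= m%:R ^+ n * \sum_(j < m) u j ^+ n.
Proof.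
move=> n_gt0 u_ge0; pose M := \big[Num.max/0]_(j < m) u j.
have M_ge0 : 0 <= M by exact: bigmax_ge_id.
have sum_ge0 : 0 <= \sum_(j < m) u j ^+ n.
  by apply: sumr_ge0 => j _; rewrite exprn_ge0.
apply: (@le_trans _ _ ((m%:R * M) ^+ n)).
  rewrite lerXn2r ?nnegrE ?sumr_ge0 ?mulr_ge0//.
  apply: (@le_trans _ _ (\sum_(j < m) M)).
    by apply: ler_sum => j _; exact: le_bigmax.
  by rewrite sumr_const card_ord mulr_natl.
rewrite exprMn ler_wpM2l ?exprn_ge0//.
rewrite /M; elim/big_ind: _ => [|x y hx hy|j _].
- by rewrite expr0n gtn_eqF.
- by rewrite /Num.max; case: ifP.
- by rewrite (bigD1 j)//= lerDl sumr_ge0// => i _; rewrite exprn_ge0.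
Qed.

(** Chains of [m] steps are run simultaneously for all [i]: an estimate of each step, summed over
    the family, yields one for the endpoints with a constant independent of [k]. *)
Lemma sum_enorm_path n l k m (g : 'I_k -> nat -> 'rV[R]_l) (eps : R) :
  (0 < n)%N ->
  (forall j, (j < m)%N -> \sum_(i < k) enorm (g i j - g i j.+1) ^+ n <= eps) ->
  \sum_(i < k) enorm (g i 0%N - g i m) ^+ n <=
    (l%:R * m%:R) ^+ n * (m%:R * eps).
Proof.
move=> n_gt0 step.
apply: (@le_trans _ _ (\sum_(i < k) (l%:R * m%:R) ^+ n *
    \sum_(j < m) enorm (g i j - g i j.+1) ^+ n)).
  apply: ler_sum => i _.
  apply: (@le_trans _ _
      ((l%:R * \sum_(j < m) enorm (g i j - g i j.+1)) ^+ n)).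
    rewrite lerXn2r ?nnegrE ?enorm_ge0 ?enorm_path// mulr_ge0// sumr_ge0//.
    by move=> j _; exact: enorm_ge0.
  rewrite !exprMn -mulrA ler_wpM2l ?exprn_ge0//.
  by apply: expr_sum_le => // j; exact: enorm_ge0.
rewrite -mulr_sumr ler_wpM2l ?exprn_ge0 ?mulr_ge0//.
rewrite exchange_big/=.
apply: (@le_trans _ _ (\sum_(j < m) eps)).
  by apply: ler_sum => j _; exact: step.
by rewrite sumr_const card_ord mulr_natl.
Qed.

End EuclideanNorm.

(** * Regularity expressed through side lengths *)

Section Regularity.
Context {R : realType}.

Lemma alpha_regular_closed_interval n (alpha : R) (a b : 'rV[R]_n.+1) :
  (forall i, a ord0 i < b ord0 i) ->
  (alpha%:E <= lebesgue (closed_interval a b) / (max_side a b ^+ n.+1)%:E)%E =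
  (alpha * max_side a b ^+ n.+1 <= \prod_(i < n.+1) (b ord0 i - a ord0 i)).
Proof.
move=> ltab; have side_gt0 : 0 < max_side a b ^+ n.+1.
  rewrite exprn_gt0//; apply: (lt_le_trans _ (le_bigmax _ _ ord0)).
  by rewrite normr_gt0 subr_eq0 lt_eqF.
rewrite lebesgue_closed_interval => [|i]; last exact: ltW.
by rewrite inver gt_eqF// lee_pdivlMr.
Qed.

Lemma max_side_sides n (a b : 'rV[R]_n) (v : R) : 0 <= v ->
  (forall i, a ord0 i <= b ord0 i) -> (forall i, b ord0 i - a ord0 i <= v) ->
  max_side a b <= v.
Proof.
move=> v_ge0 leab sides; apply: bigmax_le => // i _.
by rewrite distrC ger0_norm ?subr_ge0.
Qed.

Lemma side_le_max_side n (a b : 'rV[R]_n) i :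
  b ord0 i - a ord0 i <= max_side a b.
Proof.
apply: (@le_trans _ _ `|a ord0 i - b ord0 i|); last exact: le_bigmax.
by rewrite distrC ler_norm.
Qed.

(** The volume is at least [u ^+ n.+1], while the longest side is at most [v]. *)
Lemma alpha_regular_sides n (alpha u v : R) (a b : 'rV[R]_n.+1) :
  0 <= alpha -> 0 < u -> (forall i, u <= b ord0 i - a ord0 i <= v) ->
  alpha * v ^+ n.+1 <= u ^+ n.+1 -> alpha_regular alpha a b.
Proof.
move=> alpha_ge0 u_gt0 sides auv.
have ltab i : a ord0 i < b ord0 i.
  by rewrite -subr_gt0 (lt_le_trans u_gt0)//; case/andP: (sides i).
have v_ge0 : 0 <= v.
  by have /andP[uab abv] := sides ord0; apply: le_trans (le_trans uab abv); exact: ltW.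
split=> //; rewrite alpha_regular_closed_interval//.
apply: (@le_trans _ _ (u ^+ n.+1)).
  apply: le_trans auv; rewrite ler_wpM2l// lerXn2r ?nnegrE//.
    exact: bigmax_ge_id.
  apply: max_side_sides => // i; first exact: ltW.
  by case/andP: (sides i).
rewrite -[in leLHS](card_ord n.+1) -prodr_const; apply: ler_prod => i _.
by rewrite (ltW u_gt0)/=; case/andP: (sides i).
Qed.

(** In the volume, all sides but the [i]-th are bounded by the longest one, whose [n]-th power then
    cancels. *)
Lemma alpha_regular_side_ge n (alpha : R) (a b : 'rV[R]_n.+1) i :
  alpha_regular alpha a b -> alpha * max_side a b <= b ord0 i - a ord0 i.
Proof.
move=> [ltab]; rewrite alpha_regular_closed_interval//.
have M_gt0 : 0 < max_side a b.
  by apply: lt_le_trans (side_le_max_side a b ord0); rewrite subr_gt0.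
rewrite (bigD1 i)//= exprSr mulrA => le_prod.
rewrite -(ler_pM2r (exprn_gt0 n M_gt0)).
rewrite mulrAC; apply: (le_trans le_prod).
rewrite ler_wpM2l//; first by rewrite subr_ge0 ltW.
have -> : max_side a b ^+ n = \prod_(j < n.+1 | j != i) max_side a b.
  by rewrite prodr_const cardC1 card_ord.
apply: ler_prod => j _.
by rewrite subr_ge0 ltW//= side_le_max_side.
Qed.

End Regularity.

(** * The classes restated for auxiliary sets inside a given disjoint family *)

Section Classes.
Context {R : realType}.

Lemma trivIset_sub (I T : Type) (A B : I -> set T) :
  (forall i, A i `<=` B i) -> trivIset setT B -> trivIset setT A.
Proof.
move=> AB trB i j _ _ [x [Aix Ajx]]; apply: trB => //.
by exists x; split; exact: AB.
Qed.

Lemma sum_lebesgueS n k (A B : 'I_k -> set 'rV[R]_n) (d : \bar R) :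
  (forall i, A i `<=` B i) -> (\sum_(i < k) lebesgue (B i) < d)%E ->
  (\sum_(i < k) lebesgue (A i) < d)%E.
Proof.
move=> AB; apply: le_lt_trans; apply: lee_sum => i _; exact: lebesgueS.
Qed.

Lemma osc_ge n l (f : 'rV[R]_n -> 'rV[R]_l) (E : set 'rV[R]_n) x y :
  E x -> E y -> ((enorm (f x - f y))%:E <= osc f E)%E.
Proof. by move=> Ex Ey; apply: ereal_sup_ubound; exists x => //; exists y. Qed.

Lemma osc_expn_ge n l (f : 'rV[R]_n -> 'rV[R]_l) (E : set 'rV[R]_n) m x y :
  E x -> E y -> ((enorm (f x - f y) ^+ m)%:E <= osc f E ^+ m)%E.
Proof.
move=> Ex Ey; have := osc_ge f Ex Ey; have := enorm_ge0 (f x - f y).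
case: (osc f E) => [r| |] e_ge0; last by rewrite leNgt ltNyr.
  rewrite lee_fin => er; rewrite -EFin_expe lee_fin lerXn2r// nnegrE//.
  exact: le_trans er.
by case: m => [|m] _; rewrite ?expr0 ?expe0//; rewrite expeS gt0_mulye ?leey// expe_gt0.
Qed.

(** The bound forces every oscillation to be finite, so each is at most twice a distance between
    values at two points of [E i]; hence the factor [2 ^+ m]. *)
Lemma sum_osc_le n l m k (f : 'rV[R]_n -> 'rV[R]_l)
    (E : 'I_k -> set 'rV[R]_n) (M : R) :
  (0 < m)%N -> (forall i, E i !=set0) ->
  (forall x y : 'I_k -> 'rV[R]_n, (forall i, E i (x i)) ->
    (forall i, E i (y i)) -> \sum_(i < k) enorm (f (x i) - f (y i)) ^+ m <= M) ->
  (\sum_(i < k) osc f (E i) ^+ m <= (2 ^+ m * M)%:E)%E.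
Proof.
move=> m_gt0 /choice[p Ep] bound.
have osc_fin i : exists2 s, 0 <= s & osc f (E i) = s%:E.
  have le_osc : (osc f (E i) <= (1 + M)%:E)%E.
    apply: ge_ereal_sup => _ [x Ex [y Ey <-]]; rewrite lee_fin.
    (* Only the [i]-th point moves and the others stay at [p], so the bound on the sum controls the
       [i]-th term. *)
    pose upd z j := if j == i then z else p j.
    have Eupd z j : E i z -> E j (upd z j) by rewrite /upd; case: eqP => [->|].
    have := bound (upd x) (upd y) (fun j => Eupd x j Ex) (fun j => Eupd y j Ey).
    rewrite (bigD1 i)//= {1 2}/upd eqxx => sumM.
    have e_ge0 := enorm_ge0 (f x - f y).
    have leM : enorm (f x - f y) ^+ m <= M.
      apply: le_trans sumM; rewrite lerDl sumr_ge0// => j _.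
      by rewrite exprn_ge0// enorm_ge0.
    (* A distance above 1 is at most its [m]-th power, hence at most [M]; [1 + M] covers both
       cases. *)
    have [e1|e1] := leP (enorm (f x - f y)) 1.
      by apply: (le_trans e1); rewrite lerDl (le_trans _ leM)// exprn_ge0.
    apply: (@le_trans _ _ (enorm (f x - f y) ^+ m)); first exact: ler_eXnr (ltW e1).
    by apply: (le_trans leM); rewrite lerDr.
  have osc_ge0 : (0 <= osc f (E i))%E.
    by apply: le_trans (osc_ge f (Ep i) (Ep i)); rewrite lee_fin enorm_ge0.
  exists (fine (osc f (E i))); first exact: fine_ge0.
  rewrite fineK// ge0_fin_numE//; exact: le_lt_trans le_osc (ltry _).
have [s s_ge0 sE] : exists2 s : 'I_k -> R, (forall i, 0 <= s i) &
    forall i, osc f (E i) = (s i)%:E.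
  have /choice[s sP] : forall i, exists s, 0 <= s /\ osc f (E i) = s%:E.
    by move=> i; have [s] := osc_fin i; exists s.
  by exists s => i; have [] := sP i.
have /choice[xy xyP] : forall i, exists xy : 'rV[R]_n * 'rV[R]_n,
    [/\ E i xy.1, E i xy.2 & s i <= 2 * enorm (f xy.1 - f xy.2)].
  move=> i; have := s_ge0 i; rewrite le_eqVlt => /predU1P[s0|s_gt0].
    by exists (p i, p i); split => //=; rewrite -s0 mulr_ge0// enorm_ge0.
  have : ((s i / 2)%:E < osc f (E i))%E by rewrite sE lte_fin; lra.
  move=> /ereal_sup_gt[_ [x Ex [y Ey <-]]]; rewrite lte_fin => lt_o.
  by exists (x, y); split => //=; lra.
rewrite (eq_bigr (fun i => (s i ^+ m)%:E)) => [|i _]; last by rewrite sE EFin_expe.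
rewrite sumEFin lee_fin.
apply: (@le_trans _ _
    (\sum_(i < k) 2 ^+ m * enorm (f (xy i).1 - f (xy i).2) ^+ m)).
  apply: ler_sum => i _; have [_ _ oi] := xyP i.
  by rewrite -exprMn lerXn2r// nnegrE// mulr_ge0// enorm_ge0.
rewrite -mulr_sumr ler_wpM2l// bound// => i; by have [] := xyP i.
Qed.

Lemma alpha_AC_le n l (alpha beta : R) (Omega : set 'rV[R]_n) :
  alpha <= beta -> alpha_AC l alpha Omega `<=` alpha_AC l beta Omega.
Proof.
move=> le_ab f ACf eps eps_gt0.
have [delta delta_gt0 small] := ACf _ eps_gt0.
exists delta => // k a b reg; apply: small => i.
have [ltab le_b] := reg i; split=> //; apply: le_trans le_b.
by rewrite lee_fin.
Qed.

(** [delta] depends on neither the sets [A i] nor the intervals, so one smallness condition on the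
    [A i] serves every step of a chain inside them. *)
Lemma alpha_AC_family n l (alpha eps : R) (Omega : set 'rV[R]_n) f :
  alpha_AC l alpha Omega f -> 0 < eps ->
  exists2 delta : R, 0 < delta & forall k (A : 'I_k -> set 'rV[R]_n),
    (forall i, A i `<=` Omega) -> trivIset setT A ->
    (\sum_(i < k) lebesgue (A i) < delta%:E)%E ->
    forall a b : 'I_k -> 'rV[R]_n,
    (forall i, alpha_regular alpha (a i) (b i)) ->
    (forall i, closed_interval (a i) (b i) `<=` A i) ->
    \sum_(i < k) enorm (f (a i) - f (b i)) ^+ n < eps.
Proof.
move=> ACf eps_gt0; have [delta delta_gt0 small] := ACf _ eps_gt0.
exists delta => // k A AO trA measA a b reg abA.
apply: small => // [i||].
- exact: subset_trans (AO i).
- exact: trivIset_sub trA.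
- exact: sum_lebesgueS measA.
Qed.

(** The counterpart for balls, with oscillations replaced by pairs of points in the shrunken
    balls. *)
Lemma Hencl_AC_family n l (Omega : set 'rV[R]_n) f :
  Hencl_AC l Omega f -> exists2 lambda : R, 0 < lambda < 1 &
  forall eps, 0 < eps ->
  exists2 delta : R, 0 < delta & forall k (A : 'I_k -> set 'rV[R]_n),
    (forall i, A i `<=` Omega) -> trivIset setT A ->
    (\sum_(i < k) lebesgue (A i) < delta%:E)%E ->
    forall (c u v : 'I_k -> 'rV[R]_n) (r : 'I_k -> R),
    (forall i, 0 < r i) ->
    (forall i, cball (c i) (r i) `<=` A i) ->
    (forall i, enorm (u i - c i) <= lambda * r i) ->
    (forall i, enorm (v i - c i) <= lambda * r i) ->
    \sum_(i < k) enorm (f (u i) - f (v i)) ^+ n < eps.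
Proof.
move=> [lambda lambda01 ACf]; exists lambda => // eps eps_gt0.
have [delta delta_gt0 small] := ACf _ eps_gt0.
exists delta => // k A AO trA measA c u v r r_gt0 cA uc vc.
rewrite -lte_fin; apply: (@le_lt_trans _ _
    (\sum_(i < k) osc f (cball (c i) (lambda * r i)) ^+ n)%E).
  by rewrite -sumEFin; apply: lee_sum => i _; apply: osc_expn_ge; [exact: uc|exact: vc].
apply: small => // [i||].
- exact: subset_trans (AO i).
- exact: trivIset_sub trA.
- exact: sum_lebesgueS measA.
Qed.

End Classes.

(** * The two inclusions *)

Section Inclusions.
Context {R : realType}.

Lemma bernoulli_ineq n (x : R) : 0 <= x <= 1 -> 1 - n%:R * x <= (1 - x) ^+ n.
Proof.
move=> /andP[x_ge0 x_le1]; elim: n => [|n IHn]; first by rewrite mul0r subr0 expr0.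
rewrite exprS; apply: (@le_trans _ _ ((1 - x) * (1 - n%:R * x))).
  have : 0 <= n%:R * x ^+ 2 by rewrite mulr_ge0// sqr_ge0.
  by rewrite -natr1; nra.
by rewrite ler_wpM2l// subr_ge0.
Qed.

Lemma ex_mul_lt (K eps : R) : 0 <= K -> 0 < eps ->
  exists2 e, 0 < e & K * e < eps.
Proof.
move=> K_ge0 eps_gt0; have K1 : 0 < K + 1 by rewrite ltr_wpDl.
exists (eps / (K + 1)); first by rewrite divr_gt0.
by rewrite mulrA ltr_pdivrMr// mulrC ltr_pM2l// ltrDl.
Qed.

Lemma alpha_AC_Hencl n l (alpha : R) (Omega : set 'rV[R]_n.+1) :
  0 < alpha < 1 -> alpha_AC l alpha Omega `<=` Hencl_AC l Omega.
Proof.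
move=> /andP[alpha_gt0 alpha_lt1] f ACf.
pose N : R := n.+1%:R.
have N_ge1 : 1 <= N by rewrite ler1n.
have N_gt0 : 0 < N by rewrite ltr0n.
(* Chosen so that Bernoulli's inequality gives [alpha <= (1 - 2 * theta) ^+ n.+1]; moreover [(1 - 2
   * theta) * (1 + theta) <= 1 - theta]. *)
pose theta := (1 - alpha) / (2 * N).
have theta_gt0 : 0 < theta by rewrite divr_gt0 ?mulr_gt0// subr_gt0.
have thetaE : 2 * N * theta = 1 - alpha.
  by rewrite /theta mulrC divfK// mulf_neq0// gt_eqF.
have theta_lt : 2 * theta < 1 by nra.
exists (theta / N).
  by rewrite divr_gt0//= ltr_pdivrMr//; lra.
have regular_power : alpha * (1 + theta) ^+ n.+1 <= (1 - theta) ^+ n.+1.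
  apply: (@le_trans _ _ (((1 - 2 * theta) * (1 + theta)) ^+ n.+1)).
    rewrite exprMn ler_wpM2r ?exprn_ge0//; first by lra.
    apply: le_trans (bernoulli_ineq n.+1 _); last by lra.
    by rewrite -/N; lra.
  by rewrite lerXn2r ?nnegrE; nra.
move=> eps eps_gt0.
(* [2 ^+ n.+1] pays for passing from oscillations to pairs of points, the other factor for a chain
   of two steps. *)
have [e e_gt0 small_e] : exists2 e, 0 < e &
    (2 ^+ n.+1 * ((l%:R * 2%:R) ^+ n.+1 * 2%:R)) * e < eps.
  by apply: ex_mul_lt => //; rewrite ?mulr_ge0 ?exprn_ge0 ?mulr_ge0.
have [delta delta_gt0 small] := alpha_AC_family ACf e_gt0.
exists delta => // k c r r_gt0 cO trc measc.
(* With this offset, coordinates within [t i] of the centre stay in the ball of radius [r i]. For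
   [x i] in the small ball, the sides of the interval from [z i] to [x i] lie between
   [t i * (1 - theta)] and [t i * (1 + theta)]. *)
pose t i := r i / N.
have t_gt0 i : 0 < t i by rewrite divr_gt0.
pose z i := c i - const_mx (t i).
have near_z (x : 'I_k -> 'rV[R]_n.+1) :
    (forall i, cball (c i) (theta / N * r i) (x i)) ->
    \sum_(i < k) enorm (f (z i) - f (x i)) ^+ n.+1 < e.
  move=> xc; have coord i j : `|x i ord0 j - c i ord0 j| <= theta * t i.
    have := le_trans (normr_coord_le_enorm (x i - c i) j) (xc i).
    by rewrite !mxE /t mulrA mulrAC.
  have zj i j : z i ord0 j = c i ord0 j - t i by rewrite !mxE.
  apply: small cO trc measc _ _ _ _ => i.
    apply: (@alpha_regular_sides _ _ _ (t i * (1 - theta)) (t i * (1 + theta))).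
    - exact: ltW.
    - by rewrite mulr_gt0//; lra.
    - move=> j; have := coord i j; rewrite ler_norml zj => /andP[? ?].
      by apply/andP; split; lra.
    - rewrite !(exprMn _ (t i)) mulrCA; apply: ler_wpM2l => //.
      by rewrite exprn_ge0// ltW.
  move=> w wzx; rewrite /cball/=.
  have -> : r i = N * t i by rewrite /t mulrC divfK// gt_eqF.
  apply: enorm_le_coord => j; rewrite !mxE.
  have := wzx j; have := coord i j; rewrite zj !ler_norml => /andP[? ?] /andP[? ?].
  have := t_gt0 i => ti; apply/andP; split; first by lra.
  have : theta * t i <= t i by nra.
  lra.
apply: (@le_lt_trans _ _ (2 ^+ n.+1 *
    ((l%:R * 2%:R) ^+ n.+1 * (2%:R * e)))%:E); last first.
  by rewrite lte_fin !mulrA in small_e *.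
apply: sum_osc_le => // [i|x y xc yc].
  exists (c i); rewrite /cball/= subrr enorm0.
  by rewrite ltW// mulr_gt0// divr_gt0.
apply: (sum_enorm_path (m := 2%N) (eps := e)
  (g := fun i j => nth 0 [:: f (x i); f (z i); f (y i)] j)) => // -[|[|//]] _ /=.
  by under eq_bigr do rewrite enormB; exact/ltW/near_z.
exact/ltW/near_z.
Qed.

Lemma cubes_and_balls_alpha_AC n l (alpha : R) (Omega : set 'rV[R]_n.+1) :
  0 < alpha < 1 -> alpha_AC l 1 Omega `&` Hencl_AC l Omega `<=`
  alpha_AC l alpha Omega.
Proof.
move=> /andP[alpha_gt0 alpha_lt1] f [AC1f /Hencl_AC_family[lambda]].
move=> /andP[lambda_gt0 lambda_lt1] Hf eps eps_gt0.
(* The segment has coordinate increments at most [m i / alpha]; more than [bound] equal steps make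
   each step at most [lambda * (m i / 2)] long. *)
pose bound := 2 * n.+1%:R / (alpha * lambda).
pose N := Num.bound bound.
have bound_gt0 : 0 < bound by rewrite divr_gt0 ?mulr_gt0.
have ltN : bound < N%:R by apply: archi_boundP; exact: ltW.
have N_gt0 : 0 < N%:R :> R := lt_trans bound_gt0 ltN.
have N_step : n.+1%:R / (alpha * N%:R) <= lambda / 2.
  move: ltN; rewrite /bound ltr_pdivrMr ?mulr_gt0// => ltN.
  by rewrite ler_pdivrMr ?mulr_gt0//; lra.
(* The chain has [N] steps on the segment and two diagonals of cubes, hence [N.+2]. *)
have [e e_gt0 small_e] : exists2 e, 0 < e &
    ((l%:R * N.+2%:R) ^+ n.+1 * N.+2%:R) * e < eps.
  by apply: ex_mul_lt => //; rewrite ?mulr_ge0 ?exprn_ge0 ?mulr_ge0.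
have [delta1 delta1_gt0 cubes] := alpha_AC_family AC1f e_gt0.
have [delta2 delta2_gt0 balls] := Hf _ e_gt0.
exists (Num.min delta1 delta2); first by rewrite lt_min delta1_gt0.
move=> k a b reg abO trab meas.
have meas1 := lt_le_trans meas (_ : _ <= delta1%:E)%E.
have meas2 := lt_le_trans meas (_ : _ <= delta2%:E)%E.
pose m i := alpha * max_side (a i) (b i).
have side_ge i j : m i <= b i ord0 j - a i ord0 j.
  exact: alpha_regular_side_ge.
have side_le i j : b i ord0 j - a i ord0 j <= m i / alpha.
  by rewrite /m mulrAC divff ?gt_eqF// mul1r side_le_max_side.
have m_gt0 i : 0 < m i.
  have [ltab _] := reg i; rewrite mulr_gt0//.
  by apply: lt_le_trans (side_le_max_side _ _ ord0); rewrite subr_gt0.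
pose p i j := a i + const_mx (m i / 2) +
  (j%:R / N%:R) *: (b i - a i - const_mx (m i)).
(* The chain is [a i], then [p i 0] to [p i N], then [b i]; indices on the segment are shifted by
   one. *)
pose g i j := if j is j'.+1 then if (j' <= N)%N then p i j' else b i else a i.
have pE i j h : p i j ord0 h = a i ord0 h + m i / 2 +
    j%:R / N%:R * (b i ord0 h - a i ord0 h - m i) by rewrite !mxE.
(* Every division point keeps distance [m i / 2] from all faces, so the ball of that radius around
   it stays inside the interval. *)
have p_in i j h : (j <= N)%N ->
    a i ord0 h + m i / 2 <= p i j ord0 h <= b i ord0 h - m i / 2.
  move=> lejN; rewrite pE.
  have s_ge0 : 0 <= j%:R / N%:R :> R by rewrite divr_ge0.
  have s_le1 : j%:R / N%:R <= 1 :> R by rewrite ler_pdivrMr// mul1r ler_nat.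
  by have := side_ge i h; move=> ?; apply/andP; split; nra.
have cube (u v : 'I_k -> 'rV[R]_n.+1) :
    (forall i h, v i ord0 h - u i ord0 h = m i / 2) ->
    (forall i h, a i ord0 h <= u i ord0 h) ->
    (forall i h, v i ord0 h <= b i ord0 h) ->
    \sum_(i < k) enorm (f (u i) - f (v i)) ^+ n.+1 < e.
  move=> uv au vb; apply: cubes abO trab _ _ _ _ _ => [|i|i x xuv h].
  - by apply: meas1; rewrite lee_fin ge_min lexx.
  - apply: (@alpha_regular_sides _ _ _ (m i / 2) (m i / 2)).
    + exact: ler01.
    + by rewrite divr_gt0.
    + by move=> h; rewrite uv lexx.
    + by rewrite mul1r.
  - have /andP[ux xv] := xuv h.
    by rewrite (le_trans _ ux)// (le_trans xv).
have p_step i j : (j <= N)%N -> enorm (p i j.+1 - p i j) <= lambda * (m i / 2).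
  move=> lejN; apply: (@le_trans _ _ (n.+1%:R * (m i / (alpha * N%:R)))).
    apply: enorm_le_coord => h; rewrite !mxE.
    rewrite [X in `|X|](_ : _ = (b i ord0 h - a i ord0 h - m i) / N%:R); last first.
      by rewrite -natr1; field; rewrite gt_eqF.
    rewrite ger0_norm; last by rewrite divr_ge0// subr_ge0 side_ge.
    rewrite invfM mulrA ler_wpM2r ?invr_ge0//.
    by have := side_le i h; have := m_gt0 i; lra.
  have -> : n.+1%:R * (m i / (alpha * N%:R)) = m i * (n.+1%:R / (alpha * N%:R)).
    by rewrite mulrCA.
  have -> : lambda * (m i / 2) = m i * (lambda / 2) by rewrite mulrCA.
  by rewrite ler_wpM2l// ltW.
apply: le_lt_trans small_e.
have gE i : f (a i) - f (b i) = f (g i 0%N) - f (g i N.+2) by rewrite /= ltnn.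
under eq_bigr do rewrite gE.
rewrite -mulrA; apply: (sum_enorm_path (g := fun i j => f (g i j))) => // j ltjN.
apply: ltW; case: j ltjN => [_|j ltjN] /=.
  apply: cube => [i h|//|i h].
  - by rewrite pE mul0r mul0r addr0 addrC addKr.
  - have /andP[_ pb] := p_in i 0%N h (leq0n _).
    by apply: le_trans pb _; rewrite gerBl divr_ge0// ltW.
have lejN : (j <= N)%N := ltjN.
rewrite lejN.
(* For [j < N] the step stays on the segment, within a shrunken ball centred at [p i j]; for [j = N]
   it is the diagonal of the last cube. *)
case: (ltnP j N) => [_|leNj].
  apply: (balls _ _ abO trab _ (fun i => p i j) _ _ (fun i => m i / 2)) => [|i|i x xp h|i|i].
  - by apply: meas2; rewrite lee_fin ge_min lexx orbT.
  - by rewrite divr_gt0.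
  - have := le_trans (normr_coord_le_enorm (x - p i j) h) xp.
    rewrite mxE [(- p i j) _ _]mxE ler_norml => /andP[? ?].
    have /andP[? ?] := p_in i j h lejN.
    by apply/andP; split; lra.
  - apply: (le_trans _ (p_step i j lejN)); rewrite subrr enorm0.
    exact: enorm_ge0.
  - exact: p_step.
have -> : j = N by apply/eqP; rewrite eqn_leq lejN.
apply: cube => [i h|i h|//].
- by rewrite pE divff ?gt_eqF// mul1r; lra.
- have /andP[ap _] := p_in i N h (leqnn _).
  by apply: le_trans _ ap; rewrite lerDl divr_ge0// ltW.
Qed.

End Inclusions.

Theorem theorem3p2 (R : realType) (n l : nat) (Omega : set 'rV[R]_n) (alpha : R)
  (hn : (0 < n)%N) (hl : (0 < l)%N) (hOmega : open Omega)
  (halpha : 0 < alpha < 1) :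
  alpha_AC l alpha Omega = alpha_AC l 1 Omega `&` Hencl_AC l Omega.
Proof.
case: n Omega hn hOmega => [//|n] Omega _ _.
rewrite eqEsubset; split; last exact: cubes_and_balls_alpha_AC.
move=> f ACf; split; last exact: alpha_AC_Hencl ACf.
by apply: alpha_AC_le ACf; case/andP: halpha => _ /ltW.
Qed.
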